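(* The function $K_2:[0,1]\times[0,1]\to\mathbb R$ is not continuous at the point $(0,0)$. Furthermore, there is no function $f:[0,1]\times[0,1]\to\mathbb R$ that is continuous at $(0,0)$ and for which the set $\{(x,y)\in[0,1]\times[0,1]: f(x,y)=K_2(x,y)\}$ is dense in $[0,1]\times[0,1]$.
   Context: Let $K:[0,1]\times[0,1]\to\mathbb R$ be defined by $K(x,y)=\frac12-\{(xy)^{-1}\}$ if $0<x,y\le 1$, and $K(x,y)=0$ if $0\le x,y\le1$ and $xy=0$, where $\{\alpha\}=\alpha-\lfloor\alpha\rfloor$. Define $K_2(x,y)=\int_0^1K(x,z)K(z,y)\,dz$ for $0\le x,y\le1$. *)

(* Defs.v *)
From HB Require Import structures.
From mathcomp Require Import all_boot all_order all_algebra.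
From mathcomp Require Import all_classical all_reals all_analysis.
Set Implicit Arguments. Unset Strict Implicit. Unset Printing Implicit Defensive.
Import Order.TTheory GRing.Theory Num.Theory.
Import numFieldNormedType.Exports.
Local Open Scope classical_set_scope.
Local Open Scope ring_scope.

Definition fracpart (R : realType) (a : R) : R := a - (Num.floor a)%:~R.

Definition K (R : realType) (x y : R) : R :=
  if (0 < x) && (0 < y) then 2^-1 - fracpart (x * y)^-1 else 0.

Definition K2 (R : realType) (x y : R) : R :=
  Rintegral (@lebesgue_measure R) `[0, 1]%classic (fun z => K x z * K z y).

Definition unit_square (R : realType) : set (R * R) :=
  [set p | 0 <= p.1 <= 1 /\ 0 <= p.2 <= 1].

Definition cont_at_origin (R : realType) (f : R * R -> R) : Prop :=
  f @ within (@unit_square R) (nbhs ((0 : R), (0 : R))) --> f (0, 0).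

(* Main.v *)
Require Import Defs.
From HB Require Import structures.
From mathcomp Require Import all_boot all_order all_algebra.
From mathcomp Require Import all_classical all_reals all_analysis.
From mathcomp Require Import measurable_realfun ring lra.
Import Order.TTheory GRing.Theory Num.Theory.
Import numFieldNormedType.Exports.
Local Open Scope classical_set_scope.
Local Open Scope ring_scope.

(** By dominated convergence [K2] is continuous at points with positive
    coordinates, so an [f] as in the second claim forces [K2 x y] to converge to
    [f (0, 0)] as [x] and [y] tend to [0] through positive values.  Then
    [K2 x x - 2 * K2 x y + K2 y y = \int_0^1 (K x z - K y z)^2 dz] would tend to
    [0]; but for [x = 1 / N] and [y = 1 / (N + 1/2)] it is at least [1/48], since
    [1 / (x z)] and [1 / (y z)] are about half a unit apart for [z] near [1].
    The first claim is the case [f = K2]. *)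

(** * Regularity of the fractional part and of the kernel [K] *)

Lemma fracpart_bounds {R : realType} (a : R) : 0 <= fracpart a < 1.
Proof. by rewrite /fracpart subr_ge0 floor_le ltrBlDl -intrD1 floorD1_gt. Qed.

(** Off the integers the floor is locally constant, so near [a] the function is a translation. *)
Lemma fracpart_continuous {R : realType} (a : R) :
  fracpart a != 0 -> {for a, continuous (@fracpart R)}.
Proof.
move=> fa0; have /andP[f0 f1] := fracpart_bounds a.
have fa : 0 < fracpart a by rewrite lt_def fa0.
have nearE : {near a, (fun t => t - (Num.floor a)%:~R) =1 @fracpart R}.
  have : a \in `](Num.floor a)%:~R, (Num.floor a + 1)%:~R[.
    by rewrite in_itv/= -subr_gt0 fa floorD1_gt.
  move=> /near_in_itvoo; apply: filterS => t; rewrite in_itv/= => /andP[t1 t2].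
  by rewrite /fracpart (@floor_def _ t (Num.floor a)) // t2 ltW.
apply: (cvg_trans (near_eq_cvg nearE)).
by apply: cvgB; [exact: cvg_id|exact: cvg_cst].
Qed.

Lemma measurable_fracpart {R : realType} :
  measurable_fun setT (@fracpart R).
Proof.
apply: measurable_funB => //; apply: nondecreasing_measurable => //.
by move=> x y xy; rewrite ler_int le_floor.
Qed.

Lemma K_sym {R : realType} (x y : R) : K x y = K y x.
Proof. by rewrite /K andbC mulrC. Qed.

Lemma K0 {R : realType} (x : R) : K x 0 = 0.
Proof. by rewrite /K ltxx andbF. Qed.

Lemma K_bound {R : realType} (x y : R) : `|K x y| <= 1.
Proof.
rewrite /K; case: ifP => _; rewrite ?normr0 //.
by have := fracpart_bounds (x * y)^-1; rewrite ler_norml; lra.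
Qed.

Lemma measurable_K {R : realType} (x : R) : measurable_fun setT (K x).
Proof.
apply: measurable_fun_if => //.
  by apply: measurable_and => //; exact: measurable_fun_ltr.
rewrite setTI; apply: measurable_funB => //.
apply: (measurableT_comp measurable_fracpart).
(* The region selected by the guard of [K] is empty if [x <= 0]; otherwise it is the open half-line
   [0 < z], on which the inverse is continuous. *)
have [x0|x0] := ltP 0 x; last first.
  rewrite (_ : _ @^-1` _ = set0); first exact: measurable_fun_set0.
  by rewrite -subset0 => z.
rewrite (_ : _ @^-1` _ = `]0, +oo[%classic); last first.
  by apply/seteqP; split => z /=; rewrite in_itv/= andbT.
apply: open_continuous_measurable_fun; first exact: interval_open.
move=> z; rewrite inE/= in_itv/= andbT => z0.
apply: cvgV; first by rewrite mulf_neq0// gt_eqF.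
by apply: cvgM; [exact: cvg_cst|exact: cvg_id].
Qed.

Lemma K_continuous {R : realType} (x z : R) : 0 < x -> 0 < z ->
  fracpart (x * z)^-1 != 0 -> {for x, continuous (fun t => K t z)}.
Proof.
move=> x0 z0 fr.
have nearE : {near x, (fun t => 2^-1 - fracpart (t * z)^-1)
    =1 (fun t => K t z)}.
  by have := lt_nbhsr x0; apply: filterS => t t0; rewrite /K t0 z0.
apply: (cvg_trans (near_eq_cvg nearE)).
rewrite {1}/K x0 z0/=; apply: cvgB; first exact: cvg_cst.
apply: (cvg_comp (fun t => (t * z)^-1)); last exact: fracpart_continuous fr.
apply: cvgV; first by rewrite mulf_neq0// gt_eqF.
by apply: cvgM; [exact: cvg_id|exact: cvg_cst].
Qed.

(** For fixed [x] the bad [z] are among the countably many points [1 / (x k)] with [k] an integer.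
    The value [k = 0] only adds the harmless point [0]. *)
Lemma ae_fracpart_neq0 {R : realType} (x : R) : 0 < x ->
  {ae (@lebesgue_measure R), forall z : R, 0 < z -> fracpart (x * z)^-1 != 0}.
Proof.
move=> x0; pose A := range (fun k : int => (x * k%:~R)^-1 : R).
have cA : countable A.
  by apply: card_le_trans (card_image_le _ _) _; exact: countableP.
exists A; split; [exact: countable_measurable|
                  exact: countable_lebesgue_measure0|].
move=> z /= /not_implyP[z0 /negP]; rewrite negbK subr_eq0 => /eqP fz.
exists (Num.floor (x * z)^-1) => //; rewrite -fz.
by rewrite invfM invrK mulKf // gt_eqF.
Qed.

(** * Continuity of [K2] at points with positive coordinates *)

Lemma integrable01_le1 {R : realType} (f : R -> R) :
  measurable_fun (`[0, 1]%classic : set (measurableTypeR R)) f ->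
  (forall z, `|f z| <= 1) ->
  (@lebesgue_measure R).-integrable `[0, 1] (EFin \o f).
Proof.
move=> mf f1; apply: measurable_bounded_integrable => //.
  by rewrite /= lebesgue_measure_itv/= lte01 oppr0 adde0 ltry.
by exists 1; split => // M M1 z _; exact: le_trans (f1 z) (ltW M1).
Qed.

Lemma integrable_KK {R : realType} (x y : R) :
  (@lebesgue_measure R).-integrable `[0, 1] (EFin \o (fun z => K x z * K z y)).
Proof.
apply: integrable01_le1 => [|z]; last by rewrite normrM mulr_ile1 ?K_bound.
apply: measurable_funTS; apply: measurable_funM; first exact: measurable_K.
by under eq_fun do rewrite K_sym; exact: measurable_K.
Qed.

(** Dominated convergence with the constant bound 1: for almost every [z], neither [1 / (x z)] nor
    [1 / (y z)] is an integer, so both factors of the integrand converge. Sequences are the form in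
    which dominated convergence applies. *)
Lemma K2_cvg {R : realType} (u v : nat -> R) (x y : R) : 0 < x -> 0 < y ->
  u n @[n --> \oo] --> x -> v n @[n --> \oo] --> y ->
  K2 (u n) (v n) @[n --> \oo] --> K2 x y.
Proof.
move=> x0 y0 ux vy.
pose f_ n (z : R) := (K (u n) z * K z (v n))%:E.
pose f (z : R) := (K x z * K z y)%:E.
have m n : measurable_fun (`[0, 1]%classic : set (measurableTypeR R)) (f_ n).
  by have /integrableP[] := integrable_KK (u n) (v n).
have mf : measurable_fun (`[0, 1]%classic : set (measurableTypeR R)) f.
  by have /integrableP[] := integrable_KK x y.
have i1 : (@lebesgue_measure R).-integrable `[0, 1] (EFin \o cst 1).
  by apply: integrable01_le1 => // z; rewrite normr1.
have ff : {ae (@lebesgue_measure R),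
    forall z, `[0, 1]%classic z -> f_ ^~ z @ \oo --> f z}.
  have := ae_fracpart_neq0 x x0; have := ae_fracpart_neq0 y y0.
  apply: (@filterS2 _ _ (ae_filter_ringOfSetsType _)) => z fy fx.
  rewrite /= in_itv/= => /andP[z0 _].
  apply: cvg_EFin; first by apply: nearW.
  (* The almost-everywhere hypotheses say nothing at [z = 0], but there every integrand vanishes. *)
  have [->|zn0] := eqVneq z 0.
    rewrite /f_ K0 mul0r; under eq_fun do rewrite /= K0 mul0r.
    exact: cvg_cst.
  have {}z0 : 0 < z by rewrite lt_def zn0.
  apply: cvgM.
    exact: (cvg_comp u _ ux (K_continuous x z x0 z0 (fx z0))).
  rewrite K_sym; under eq_fun do rewrite K_sym.
  exact: (cvg_comp v _ vy (K_continuous y z y0 z0 (fy z0))).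
have fg : {ae (@lebesgue_measure R),
    forall z n, `[0, 1]%classic z -> (`|f_ n z| <= (EFin \o cst 1%R) z)%E}.
  by apply: aeW => z n _; rewrite lee_fin normrM mulr_ile1 ?K_bound.
have [If _ ] := @dominated_convergence _ _ _ (@lebesgue_measure R) _
  (measurable_itv _) f_ f _ m mf ff i1 fg.
rewrite -(fineK (@integrable_fin_num _ _ _ (@lebesgue_measure R) _
  (measurable_itv _) _ If)).
exact: fine_cvg.
Qed.

(** * Lower bound for the second difference *)

Lemma K_diff_sqr_ge {R : realType} (N z : R) : 0 < N -> 2 / 3 <= z <= 1 ->
  16^-1 <= (K N^-1 z - K (N + 2^-1)^-1 z) ^+ 2.
Proof.
(* The two arguments of the fractional part differ by [t = 1 / (2 z)], which
   lies in [1/2, 3/4] and so stays at distance at least 1/4 from any integer. *)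
move=> N0 /andP[z1 z2]; have z0 : 0 < z by lra.
have N1 : 0 < N + 2^-1 by lra.
rewrite /K !invr_gt0 N0 N1 z0/= !invfM !invrK.
set a := N / z; set t := 2^-1 / z.
have -> : (N + 2^-1) / z = a + t by rewrite /a /t mulrDl.
have t1 : 2^-1 <= t by rewrite /t ler_pdivlMr//; lra.
have t2 : t <= 3 / 4 by rewrite /t ler_pdivrMr//; lra.
rewrite /fracpart.
set m := Num.floor a; set n := Num.floor (a + t).
have -> : 2^-1 - (a - m%:~R) - (2^-1 - (a + t - n%:~R)) = t - (n - m)%:~R.
  by rewrite intrB; lra.
have [k0|k1] := leP (n - m) 0.
  have : (n - m)%:~R <= 0 :> R by rewrite lerz0.
  nra.
have : 1 <= (n - m)%:~R :> R by rewrite ler1z.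
nra.
Qed.

(** By symmetry of [K] the combination is the integral of [(K x z - K y z) ^+ 2]. This square is
    nonnegative, and at least [1/16] on [[2/3, 1]], an interval of length [1/3]. The cross term is
    subtracted twice, rather than doubled, so that linearity of the integral applies term by
    term. *)
Lemma K2_second_difference {R : realType} (N : R) : 0 < N ->
  48^-1 <= K2 N^-1 N^-1 - K2 N^-1 (N + 2^-1)^-1 - K2 N^-1 (N + 2^-1)^-1
           + K2 (N + 2^-1)^-1 (N + 2^-1)^-1.
Proof.
move=> N0; rewrite /K2; set x := N^-1; set y := (N + 2^-1)^-1.
have mI : measurable (`[0, 1]%classic : set (measurableTypeR R)) by [].
have I := @integrable_KK R.
have IB : (@lebesgue_measure R).-integrable `[0, 1]
    (EFin \o (fun z => K x z * K z x - K x z * K z y)).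
  by have := integrableB mI (I x x) (I x y).
have IC : (@lebesgue_measure R).-integrable `[0, 1]
    (EFin \o (fun z => K x z * K z x - K x z * K z y - K x z * K z y)).
  by have := integrableB mI IB (I x y).
have ID : (@lebesgue_measure R).-integrable `[0, 1]
    (EFin \o (fun z => K x z * K z x - K x z * K z y - K x z * K z y
                        + K y z * K z y)).
  by have := integrableD mI IC (I y y).
rewrite -!RintegralB// -RintegralD//.
have -> : 48^-1 = Rintegral lebesgue_measure (`[0, 1] `&` `[2 / 3, 1]%classic)
    (cst (16^-1 : R)).
  rewrite setIidr; last first.
    by move=> z /=; rewrite !in_itv/=; lra.
  rewrite Rintegral_cst//= lebesgue_measure_itv/= lte_fin ifT; last lra.
  by rewrite -EFinB/=; lra.
rewrite Rintegral_mkcondr; apply: le_Rintegral => //.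
  apply: integrable01_le1 => [|z]; first by apply/measurable_restrict.
  rewrite patchE; case: ifP => _; first by rewrite ger0_norm//=; lra.
  by rewrite /point/= normr0.
move=> z _; rewrite patchE (K_sym z x) (K_sym z y).
have -> : K x z * K x z - K x z * K y z - K x z * K y z + K y z * K y z
  = (K x z - K y z) ^+ 2 by ring.
case: ifPn => [|_]; last exact: sqr_ge0.
by rewrite inE/= in_itv/= => zI; exact: K_diff_sqr_ge.
Qed.

(** * From density to a limit at the origin *)

Lemma closure_seq {R : realType} {T : pseudoMetricType R} (S : set T) (p : T) :
  closure S p -> exists2 u : nat -> T, (forall n, S (u n)) & u @ \oo --> p.
Proof.
move=> Sp.
have /choice[u uP] : forall n : nat, exists q, S q /\ ball p (n.+1%:R^-1 : R) q.
  move=> n; have [|q [Sq qp]] := Sp (ball p (n.+1%:R^-1 : R)); last by exists q.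
  by apply: nbhsx_ballx; rewrite invr_gt0.
exists u; first by move=> n; case: (uP n).
apply/cvg_ballP => e e0; near=> n.
have [_] := uP n; apply: le_ball; apply: ltW; near: n.
exact: near_infty_natSinv_lt (PosNum e0).
Unshelve. all: by end_near. Qed.

(** Density gives points [u n] tending to [(x, y)] at which [f] and [K2] agree. For large [n],
    [f (u n)] is close to [f (0, 0)] by continuity of [f] at the origin, and [K2] at [u n] is close
    to [K2 x y] by [K2_cvg], which is why [x] and [y] must be positive. *)
Lemma K2_cvg_origin {R : realType} (f : R * R -> R) :
  cont_at_origin f ->
  @unit_square R `<=` closure [set p | @unit_square R p /\ f p = K2 p.1 p.2] ->
  forall e : R, 0 < e -> exists2 d : R, 0 < d &
    forall x y, 0 < x < d -> 0 < y < d -> `|f (0, 0) - K2 x y| < e.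
Proof.
move=> cf dS e e0.
have e2 : 0 < e / 2 by rewrite divr_gt0.
move: cf => /cvgr_dist_lt /(_ _ e2) /nbhs_ballP[r /= r0 rP].
(* The bound [1] keeps [(x, y)] in the unit square, where density is available; the strict bound [r]
   puts [u n] in the ball of radius [r] for large [n]. *)
exists (Num.min r 1); first by rewrite lt_min r0 ltr01.
move=> x y /andP[x0]; rewrite lt_min => /andP[xr x1].
move=> /andP[y0]; rewrite lt_min => /andP[yr y1].
have [|u uS uc] := @closure_seq R _ _ (x, y) (dS (x, y) _).
  by split; rewrite /= ?(ltW x0) ?(ltW y0) ltW.
have u1 : (u n).1 @[n --> \oo] --> x by exact: (cvg_comp _ _ uc cvg_fst).
have u2 : (u n).2 @[n --> \oo] --> y by exact: (cvg_comp _ _ uc cvg_snd).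
have Kc := K2_cvg _ _ x y x0 y0 u1 u2.
near \oo => n.
have [Sn fn] := uS n.
have h1 : `|f (0, 0) - f (u n)| < e / 2.
  apply: rP => //; split; rewrite -ball_normE/= sub0r normrN.
  - have [/andP[u0 _] _] := Sn; rewrite ger0_norm//.
    by near: n; exact: (cvgr_lt _ u1).
  - have [_ /andP[u0 _]] := Sn; rewrite ger0_norm//.
    by near: n; exact: (cvgr_lt _ u2).
have h2 : `|K2 x y - K2 (u n).1 (u n).2| < e / 2.
  by near: n; move: Kc => /cvgr_dist_lt/(_ _ e2).
rewrite fn in h1.
rewrite (splitr e) (le_lt_trans _ (ltrD h1 h2))//.
by rewrite -[`|K2 x y - _|]distrC; exact: ler_distD.
Unshelve. all: by end_near. Qed.

Theorem theorem2p9 (R : realType) :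
  ~ cont_at_origin (fun p : R * R => K2 p.1 p.2) /\
  ~ (exists f : R * R -> R,
       cont_at_origin f /\
       @unit_square R `<=` closure [set p | @unit_square R p /\ f p = K2 p.1 p.2]).
Proof.
have main : ~ (exists f : R * R -> R,
       cont_at_origin f /\
       @unit_square R `<=` closure [set p | @unit_square R p /\ f p = K2 p.1 p.2]).
  move=> [f [cf dS]].
  (* The coefficients 1, -2, 1 of the second difference sum to 0 and their absolute values to 4, so
     errors below [1/200] make it less than [4/200 = 1/50 < 1/48]. *)
  have e0 : 0 < 200^-1 :> R by rewrite invr_gt0.
  have [d d0 dP] := K2_cvg_origin f cf dS _ e0.
  (* Any real [N > 1/d] will do: both [1 / N] and [1 / (N + 1/2)] then lie strictly between [0] and
     [d]. *)
  have [N N0 dN] : exists2 N : R, 0 < N & d^-1 < N.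
    by exists (d^-1 + 1); rewrite ?addr_gt0 ?invr_gt0// ltrDl.
  have inv_lt M : N <= M -> 0 < M^-1 < d.
    move=> NM; have M0 := lt_le_trans N0 NM.
    by rewrite invr_gt0 M0/= invf_plt ?posrE// (lt_le_trans dN).
  have xd := inv_lt N (lexx N).
  have yd : 0 < (N + 2^-1)^-1 < d by apply: inv_lt; lra.
  have := K2_second_difference N N0.
  have := dP _ _ xd xd; have := dP _ _ xd yd; have := dP _ _ yd yd.
  by rewrite /= !ltr_norml; lra.
split => // cK; apply: main; exists (fun p => K2 p.1 p.2); split => //.
by apply: subset_trans (@subset_closure _ _) => p.
Qed.
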